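(* Let $X,Y$ be Banach spaces (both real or both complex), let $d\in\mathbb{N}$, let $P\in\mathcal{P}(^dX,Y)$ and let $T_P\in\mathcal{L}(\hat\otimes^d_{s,\pi}X,Y)$ be the bounded linear operator associated with $P$. Let $\mathbb{V}^d_X$ be equipped with the metric $d_{s,\pi}$, and let $\nu^d_X:X\to\mathbb{V}^d_X$, $\nu^d_X(x)=x\otimes\stackrel{d}{\cdots}\otimes x$. Then $T_P|_{\mathbb{V}^d_X}:\mathbb{V}^d_X\to Y$ is a Lipschitz mapping, $P$ factors as $P=T_P|_{\mathbb{V}^d_X}\circ\nu^d_X$, and $\|T_P|_{\mathbb{V}^d_X}\|_{Lip}=\|P\|$. Moreover, if $\alpha$ is any reasonable cross norm on $\otimes^dX$, then $$\|P\|\le\bigl\|T_P|_{(\mathbb{V}^d_X,d_\alpha)}\bigr\|_{Lip}\le\frac{2^{d-1}d^d}{d!}\,\|P\|,$$ where the middle term is the Lipschitz constant of the map $T_P|_{\mathbb{V}^d_X}$ with respect to the metric $d_\alpha$ on $\mathbb{V}^d_X$.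
   Context: A map $P:X\to Y$ is a $d$-homogeneous polynomial if there is a continuous $d$-linear map $T:X\times\stackrel{d}{\cdots}\times X\to Y$ with $P(x)=T(x,\dots,x)$ for all $x$; $\mathcal{P}(^dX,Y)$ is the space of these, with norm $\|P\|=\sup\{\|P(x)\|:\|x\|\le1\}$. $\otimes^dX$ is the algebraic $d$-fold tensor product and $\otimes^d_sX$ its subspace of symmetric tensors (the span of the elements $x\otimes\stackrel{d}{\cdots}\otimes x$), with norm $\|u\|_{s,\pi}=\inf\{\sum_i|\lambda_i|\,\|x_i\|^d:\ u=\sum_i\lambda_i\,x_i\otimes\stackrel{d}{\cdots}\otimes x_i \text{ (finite sum)},\ \lambda_i \text{ scalars},\ x_i\in X\}$; $\hat\otimes^d_{s,\pi}X$ is the completion. For $P\in\mathcal{P}(^dX,Y)$, $T_P$ is the unique bounded linear operator $\hat\otimes^d_{s,\pi}X\to Y$ with $P(x)=T_P(x\otimes\stackrel{d}{\cdots}\otimes x)$ for all $x\in X$. $\mathbb{V}^d_X=\{x\otimes\stackrel{d}{\cdots}\otimes x:x\in X\}$; $d_{s,\pi}$ and $d_\alpha$ are the metrics on it induced by the norms $\|\cdot\|_{s,\pi}$ and $\alpha$; $(\mathbb{V}^d_X,d_{s,\pi})$ is called the Veronese cone of degree $d$ of $X$. $\|\cdot\|_{Lip}$ denotes the best Lipschitz constant. A norm $\alpha$ on $\otimes^dX$ is a reasonable cross norm if $\alpha(x_1\otimes\cdots\otimes x_d)\le\|x_1\|\cdots\|x_d\|$ for all $x_i\in X$, and for all $x_i^*\in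 X^*$ the functional $x_1^*\otimes\cdots\otimes x_d^*$ is $\alpha$-bounded with norm at most $\|x_1^*\|\cdots\|x_d^*\|$. *)

(* Defs.v *)
From HB Require Import structures.
From mathcomp Require Import all_boot all_order all_algebra.
From mathcomp Require Import generic_quotient.
From mathcomp Require Import all_classical all_reals topology normedtype.
From mathcomp Require Export complex.

Set Implicit Arguments.
Unset Strict Implicit.
Unset Printing Implicit Defensive.
Import Order.TTheory GRing.Theory Num.Theory.
Import numFieldNormedType.Exports.
Local Open Scope classical_set_scope.
Local Open Scope ring_scope.
Local Open Scope quotient_scope.

Definition multilinear (K : numFieldType) (X W : lmodType K) (d : nat)
    (f : ('I_d -> X) -> W) : Prop :=
  forall (x : 'I_d -> X) (i : 'I_d) (a : K) (u v : X),
    f (dfwith x i (a *: u + v)) = a *: f (dfwith x i u) + f (dfwith x i v).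

(* The algebraic tensor power of degree d of X is the quotient of the formal
   linear combinations of elements of X^d by the relations that hold under
   every d-linear map. Its universal property is tlift_tens, tlift_linear and
   tlift_unique below. *)
Section TensorPower.
Variables (K : numFieldType) (X : lmodType K) (d : nat).

Definition fsum : Type := seq (K * ('I_d -> X)).
HB.instance Definition _ := Choice.on fsum.

Definition feval (W : lmodType K) (f : ('I_d -> X) -> W) (s : fsum) : W :=
  \sum_(p <- s) p.1 *: f p.2.

Definition fequiv (s t : fsum) : bool :=
  `[< forall (W : lmodType K) (f : ('I_d -> X) -> W),
        multilinear f -> feval f s = feval f t >].

Lemma fequiv_refl : reflexive fequiv.
Proof. by move=> s; apply/asboolP. Qed.

Lemma fequiv_sym : symmetric fequiv.
Proof.
by move=> s t; apply/asboolP/asboolP => h W f hf; rewrite h.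
Qed.

Lemma fequiv_trans : transitive fequiv.
Proof.
move=> s t u /asboolP h1 /asboolP h2; apply/asboolP => W f hf.
by rewrite h1// h2.
Qed.

Canonical fequiv_rel := EquivRel fequiv fequiv_refl fequiv_sym fequiv_trans.

Definition tensor : Type := {eq_quot fequiv_rel}.
HB.instance Definition _ := Choice.on tensor.
HB.instance Definition _ := EqQuotient.on tensor.

Definition tlift (W : lmodType K) (f : ('I_d -> X) -> W) (u : tensor) : W :=
  feval f (repr u).

Definition tens (x : 'I_d -> X) : tensor := \pi_tensor [:: (1, x)].

Lemma tlift_pi (W : lmodType K) (f : ('I_d -> X) -> W) s :
  multilinear f -> tlift f (\pi_tensor s) = feval f s.
Proof.
move=> hf; rewrite /tlift; have /eqquotP/asboolP := reprK (\pi_tensor s).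
exact.
Qed.

Lemma tlift_tens (W : lmodType K) (f : ('I_d -> X) -> W) x :
  multilinear f -> tlift f (tens x) = f x.
Proof. by move=> hf; rewrite tlift_pi// /feval big_seq1 scale1r. Qed.

Lemma tensor_ext (u v : tensor) :
  (forall (W : lmodType K) (f : ('I_d -> X) -> W),
     multilinear f -> tlift f u = tlift f v) -> u = v.
Proof.
move=> h; rewrite -[u]reprK -[v]reprK; apply/eqquotP/asboolP => W f hf.
exact: h.
Qed.

Definition tzero : tensor := \pi_tensor [::].
Definition tadd (u v : tensor) : tensor := \pi_tensor (repr u ++ repr v).
Definition tscale (a : K) (u : tensor) : tensor :=
  \pi_tensor [seq (a * p.1, p.2) | p <- repr u].
Definition topp (u : tensor) : tensor := tscale (-1) u.

Lemma tlift0 (W : lmodType K) (f : ('I_d -> X) -> W) :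
  multilinear f -> tlift f tzero = 0.
Proof. by move=> hf; rewrite tlift_pi// /feval big_nil. Qed.

Lemma tliftD (W : lmodType K) (f : ('I_d -> X) -> W) u v :
  multilinear f -> tlift f (tadd u v) = tlift f u + tlift f v.
Proof. by move=> hf; rewrite tlift_pi// /feval big_cat. Qed.

Lemma tliftZ (W : lmodType K) (f : ('I_d -> X) -> W) a u :
  multilinear f -> tlift f (tscale a u) = a *: tlift f u.
Proof.
move=> hf; rewrite tlift_pi// /feval big_map scaler_sumr.
by apply: eq_bigr => p _; rewrite scalerA.
Qed.

Lemma taddA : associative tadd.
Proof. by move=> u v w; apply: tensor_ext => W f hf; rewrite !tliftD// addrA. Qed.

Lemma taddC : commutative tadd.
Proof. by move=> u v; apply: tensor_ext => W f hf; rewrite !tliftD// addrC. Qed.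

Lemma tadd0 : left_id tzero tadd.
Proof.
by move=> u; apply: tensor_ext => W f hf; rewrite tliftD// tlift0// add0r.
Qed.

Lemma taddN : left_inverse tzero topp tadd.
Proof.
move=> u; apply: tensor_ext => W f hf.
by rewrite tliftD// tlift0// tliftZ// scaleN1r addNr.
Qed.

HB.instance Definition _ := GRing.isZmodule.Build tensor taddA taddC tadd0 taddN.

Lemma tscaleA a b u : tscale a (tscale b u) = tscale (a * b) u.
Proof. by apply: tensor_ext => W f hf; rewrite !tliftZ// scalerA. Qed.

Lemma tscale1 : left_id 1 tscale.
Proof. by move=> u; apply: tensor_ext => W f hf; rewrite tliftZ// scale1r. Qed.

Lemma tscaleDr : right_distributive tscale +%R.
Proof.
by move=> a u v; apply: tensor_ext => W f hf; rewrite !(tliftZ, tliftD)// scalerDr.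
Qed.

Lemma tscaleDl u : {morph tscale^~ u : a b / a + b}.
Proof.
by move=> a b; apply: tensor_ext => W f hf; rewrite !(tliftZ, tliftD)// scalerDl.
Qed.

HB.instance Definition _ :=
  GRing.Zmodule_isLmodule.Build K tensor tscaleA tscale1 tscaleDr tscaleDl.

Lemma tlift_linear (W : lmodType K) (f : ('I_d -> X) -> W) :
  multilinear f -> linear (tlift f).
Proof. by move=> hf a u v; rewrite tliftD// tliftZ. Qed.

Lemma tens_multilinear : multilinear tens.
Proof.
move=> x i a u v; apply: tensor_ext => W f hf.
by rewrite tliftD// tliftZ// !tlift_tens.
Qed.

Lemma tensE (u : tensor) : u = \sum_(p <- repr u) p.1 *: tens p.2.
Proof.
apply: tensor_ext => W f hf.
suff -> : tlift f (\sum_(p <- repr u) p.1 *: tens p.2)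
        = \sum_(p <- repr u) p.1 *: f p.2 by [].
elim: (repr u) => [|p s IH]; first by rewrite !big_nil tlift0.
by rewrite !big_cons tliftD// tliftZ// tlift_tens// IH.
Qed.

Lemma tlift_unique (W : lmodType K) (f : ('I_d -> X) -> W)
    (g : {linear tensor -> W}) :
  (forall x, g (tens x) = f x) -> g =1 tlift f.
Proof.
move=> gf u; rewrite {1}(tensE u) raddf_sum /tlift /feval.
by apply: eq_bigr => p _; rewrite [LHS]linearZ gf.
Qed.

End TensorPower.

Section SymmetricTensors.
Variables (K : numFieldType) (X : lmodType K) (d : nat).

Definition symmetric_tensor : {pred tensor X d} := fun u =>
  `[< exists (n : nat) (lambda : 'I_n -> K) (x : 'I_n -> X),
        u = \sum_(i < n) lambda i *: tens (fun _ : 'I_d => x i) >].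

Lemma symmetric_tensor_submod : submod_closed symmetric_tensor.
Proof.
split.
  by apply/asboolP; exists 0%N, (fun=> 0), (fun=> 0); rewrite big_ord0.
move=> a u v /asboolP[m [l [x ->]]] /asboolP[n [k [y ->]]]; apply/asboolP.
exists (m + n)%N.
exists (fun i : 'I_(m + n) => match fintype.split i with inl j => a * l j | inr j => k j end).
exists (fun i : 'I_(m + n) => match fintype.split i with inl j => x j | inr j => y j end).
rewrite big_split_ord/= scaler_sumr; congr (_ + _); apply: eq_bigr => i _.
  by have -> := unsplitK (inl i : 'I_m + 'I_n); rewrite scalerA.
by have -> := unsplitK (inr i : 'I_m + 'I_n).
Qed.

HB.instance Definition _ := GRing.isSubmodClosed.Build K (tensor X d)
  symmetric_tensor (GRing.submod_closed_semi symmetric_tensor_submod).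

Definition stensor : Type := {u : tensor X d | u \in symmetric_tensor}.
HB.instance Definition _ := SubChoice.on stensor.
HB.instance Definition _ := [SubChoice_isSubLmodule of stensor by <:].

Lemma tens_diag_sym (x : X) : tens (fun _ : 'I_d => x) \in symmetric_tensor.
Proof.
apply/asboolP; exists 1%N, (fun=> 1), (fun=> x).
by rewrite big_ord1 scale1r.
Qed.

Definition tens_diag (x : X) : stensor :=
  exist (fun u => u \in symmetric_tensor) _ (tens_diag_sym x).

Definition veronese_cone : Type := set_type (range tens_diag).

Definition veronese (x : X) : veronese_cone :=
  exist _ (tens_diag x) (mem_set (imageT tens_diag x)).

End SymmetricTensors.

(* Norms, suprema and infima take their values in K, as `|x| does for a
   normedModType K. When K = R[i], an order relation between elements of K
   forces their imaginary parts to be equal, so least upper bounds and greatest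
   lower bounds of sets of nonnegative elements are those of the real line.
   supremum 0 and infimum 0 return 0 where no such bound exists. *)

Definition sup_norm (K : numFieldType) (X Y : normedModType K) (f : X -> Y) : K :=
  supremum 0 [set `|f x| | x in [set x : X | `|x| <= 1]].

Definition homogeneous_polynomial (K : numFieldType) (X Y : normedModType K)
    (d : nat) (P : X -> Y) : Prop :=
  exists T : ('I_d -> X) -> Y,
    [/\ multilinear T,
        continuous (T : prod_topology (fun _ : 'I_d => X) -> Y)
      & forall x, P x = T (fun _ => x)].

Definition is_norm (K : numFieldType) (V : lmodType K) (N : V -> K) : Prop :=
  [/\ forall u, 0 <= N u,
      forall u, N u = 0 -> u = 0,
      forall a u, N (a *: u) = `|a| * N u
    & forall u v, N (u + v) <= N u + N v].

Definition reasonable_cross_norm (K : numFieldType) (X : normedModType K)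
    (d : nat) (alpha : tensor X d -> K) : Prop :=
  [/\ is_norm alpha,
      forall x : 'I_d -> X, alpha (tens x) <= \prod_(i < d) `|x i|
    & forall phi : 'I_d -> {linear X -> K^o},
        (forall i, continuous (phi i)) ->
        forall u : tensor X d,
          `|tlift (fun x : 'I_d -> X => \prod_(i < d) phi i (x i) : K^o) u|
            <= (\prod_(i < d) sup_norm (phi i)) * alpha u].

Definition spi_norm (K : numFieldType) (X : normedModType K) (d : nat)
    (u : stensor X d) : K :=
  infimum 0 [set c | exists (n : nat) (lambda : 'I_n -> K) (x : 'I_n -> X),
    u = \sum_(i < n) lambda i *: tens_diag d (x i) /\
    c = \sum_(i < n) `|lambda i| * `|x i| ^+ d].

(* E is a completion of the normed space (stensor X d, spi_norm) and iota is the
   canonical embedding; this determines E up to isometric isomorphism. *)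
Definition spi_completion (K : numFieldType) (X : normedModType K) (d : nat)
    (E : completeNormedModType K) (iota : stensor X d -> E) : Prop :=
  (forall u, `|iota u| = spi_norm u) /\ dense (range iota).

Definition spi_dist (K : numFieldType) (X : normedModType K) (d : nat)
    (u v : veronese_cone X d) : K := spi_norm (val u - val v).

Definition norm_dist (K : numFieldType) (X : normedModType K) (d : nat)
    (alpha : tensor X d -> K) (u v : veronese_cone X d) : K :=
  alpha (val (val u) - val (val v)).

(* The condition 0 <= L matters only when S has at most one point. *)
Definition lipschitz_bounds (K : numFieldType) (S : Type) (Y : normedModType K)
    (dist : S -> S -> K) (f : S -> Y) : set K :=
  [set L | 0 <= L /\ forall u v, `|f u - f v| <= L * dist u v].

Definition lipschitz_map (K : numFieldType) (S : Type) (Y : normedModType K)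
    (dist : S -> S -> K) (f : S -> Y) : Prop :=
  lipschitz_bounds dist f !=set0.

Definition lip_const (K : numFieldType) (S : Type) (Y : normedModType K)
    (dist : S -> S -> K) (f : S -> Y) : K :=
  infimum 0 (lipschitz_bounds dist f).

(* The restriction to the Veronese cone of an operator T on the completion E,
   the cone being seen inside E through iota. *)
Definition cone_restriction (K : numFieldType) (X Y : normedModType K) (d : nat)
    (E : completeNormedModType K) (iota : stensor X d -> E) (T : E -> Y) :
  veronese_cone X d -> Y := fun u => T (iota (val u)).

(* Main.v *)
(* Lipschitz constant for d_{s,pi}: writing u - v = sum_i lambda_i x_i^d gives
   |T_P (u - v)| <= |P| sum_i |lambda_i| |x_i|^d, and comparing x^d with
   0 = 0^d shows that |P| cannot be improved.

   For a reasonable cross norm alpha, let e_1, e_2 be an approximate Auerbach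
   basis of span(x, y) whose coordinate functionals g_1, g_2 are defined on X and
   have norm at most 1. Expanding all but one argument of the symmetric d-linear
   map S of P in this basis writes P x - P y as a sum of 2^(d-1) terms
   S(e_{k_2}, ..., e_{k_d}, w_k), where
   w_k = (prod_i g_{k_i} x) x - (prod_i g_{k_i} y) y.
   If psi is a functional norming w_k, then |w_k| = |psi w_k| is the modulus of
   psi (x) g_{k_2} (x) ... (x) g_{k_d} at x^d - y^d, hence at most
   alpha(x^d - y^d), while |S| <= d^d/d! |P| by polarization. *)
Require Import Defs.
From HB Require Import structures.
From mathcomp Require Import all_boot all_order all_algebra.
From mathcomp Require Import fingroup perm.
From mathcomp Require Import all_classical all_reals topology normedtype.
From mathcomp Require Import ring lra.
Set Implicit Arguments.
Unset Strict Implicit.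
Unset Printing Implicit Defensive.
Import Order.TTheory GRing.Theory Num.Theory.
Import numFieldNormedType.Exports.
Local Open Scope classical_set_scope.
Local Open Scope ring_scope.

(** * Norming functionals *)

Section HahnBanach.
Variables (R : realType) (V : lmodType R).
Implicit Types (p q : V -> R) (G : set (V -> R)).

Definition sublinear q :=
  (forall u v, q (u + v) <= q u + q v) /\
  (forall a u, 0 < a -> q (a *: u) <= a * q u).

Lemma sublinearZ q a u : sublinear q -> 0 < a -> q (a *: u) = a * q u.
Proof.
move=> [_ qZ] a0; apply/le_anti; rewrite qZ//=.
have := qZ a^-1 (a *: u); rewrite invr_gt0 => /(_ a0).
by rewrite scalerA mulVf ?gt_eqF// scale1r ler_pdivlMl.
Qed.

Lemma sublinear0 q : sublinear q -> q 0 = 0.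
Proof.
move=> sq; have := sublinearZ 0 sq (ltr0Sn R 1); rewrite scaler0; lra.
Qed.

Lemma sublinear_geN q u : sublinear q -> - q (- u) <= q u.
Proof.
by move=> sq; have := sq.1 u (- u); rewrite subrr sublinear0// -lerBlDr sub0r.
Qed.

Definition pointwise_inf G (u : V) : R := inf [set g u | g in G].

Lemma pointwise_inf_le p G g u : (forall f, G f -> forall v, - p (- v) <= f v) ->
  G g -> pointwise_inf G u <= g u.
Proof.
move=> Gp Gg; apply: ge_inf; last by exists g.
by exists (- p (- u)) => _ [f Gf <-]; exact: Gp.
Qed.

Lemma pointwise_inf_ge G u c : G !=set0 -> (forall g, G g -> c <= g u) ->
  c <= pointwise_inf G u.
Proof.
move=> [g Gg] h; apply: lb_le_inf; first by exists (g u); exists g.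
by move=> _ [f Gf <-]; exact: h.
Qed.

(** Used for a one-parameter family and for chains. Since an infimum is taken, [G] need only be
    closed under sums and dilations up to domination. The lower bound by [p] keeps [inf] away from
    its default value. *)
Lemma pointwise_inf_sublinear p G : G !=set0 ->
  (forall g, G g -> forall u, - p (- u) <= g u) ->
  (forall f g, G f -> G g ->
     exists2 h, G h & forall u v, h (u + v) <= f u + g v) ->
  (forall g a, G g -> 0 < a ->
     exists2 h, G h & forall u, h (a *: u) <= a * g u) ->
  sublinear (pointwise_inf G).
Proof.
move=> G0 Gp GD GZ; split=> [u v|a u a0].
  rewrite -lerBlDr; apply: pointwise_inf_ge => // f Gf.
  rewrite lerBlDr -lerBlDl; apply: pointwise_inf_ge => // g Gg.
  have [h Gh hfg] := GD _ _ Gf Gg.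
  by rewrite lerBlDl (le_trans _ (hfg u v))// (pointwise_inf_le _ Gp).
rewrite -ler_pdivrMl//; apply: pointwise_inf_ge => // g Gg.
have [h Gh hg] := GZ _ _ Gg a0.
by rewrite ler_pdivrMl// (le_trans _ (hg u))// (pointwise_inf_le _ Gp).
Qed.

(** The smaller functional is the infimum over t >= 0 of q(u + t w) - t q(w): t = 0 shows that it
    lies below q, and t = 1 gives the bound at - w. *)
Lemma sublinear_lower q w : sublinear q ->
  exists q', [/\ sublinear q', forall u, q' u <= q u & q' (- w) <= - q w].
Proof.
move=> sq; pose G := [set g : V -> R | exists2 t, 0 <= t &
  g = fun u => q (u + t *: w) - t * q w].
have qZ t u : 0 <= t -> q (t *: u) = t * q u.
  rewrite le_eqVlt => /predU1P[<-|t0]; last exact: sublinearZ.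
  by rewrite scale0r mul0r sublinear0.
(* Subadditivity on t w = (u + t w) + (- u) keeps the infimum finite. *)
have Gq : forall g, G g -> forall u, - q (- u) <= g u.
  move=> _ [t t0 ->] u; rewrite lerBrDl -qZ//.
  by rewrite lerBlDr (le_trans _ (sq.1 _ _))// addrAC subrr add0r.
exists (pointwise_inf G); split.
- apply: pointwise_inf_sublinear Gq _ _.
  + by exists (fun u => q (u + 0 *: w) - 0 * q w); exists 0.
  + move=> _ _ [s s0 ->] [t t0 ->].
    exists (fun u => q (u + (s + t) *: w) - (s + t) * q w).
      by exists (s + t) => //; exact: addr_ge0.
    move=> u v; rewrite scalerDl addrACA.
    by have := sq.1 (u + s *: w) (v + t *: w); lra.
  + move=> _ a [t t0 ->] a0.
    exists (fun u => q (u + (a * t) *: w) - (a * t) * q w).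
      by exists (a * t) => //; rewrite mulr_ge0// ltW.
    by move=> u; rewrite -scalerA -scalerDr sublinearZ// mulrBr mulrA.
- move=> u; have : G (fun u => q (u + 0 *: w) - 0 * q w) by exists 0.
  move=> /(pointwise_inf_le u Gq) /le_trans; apply.
  by rewrite scale0r addr0 mul0r subr0.
- have : G (fun u => q (u + 1 *: w) - 1 * q w) by exists 1.
  move=> /(pointwise_inf_le (- w) Gq) /le_trans; apply.
  by rewrite scale1r addNr mul1r sublinear0// sub0r.
Qed.

Lemma sublinear_minimal p : sublinear p ->
  exists q, [/\ sublinear q, forall u, q u <= p u &
    forall q', sublinear q' -> (forall u, q' u <= q u) -> q' = q].
Proof.
move=> sp; pose T := {q : V -> R | sublinear q /\ forall u, q u <= p u}.
(* The order is reversed, so that Zorn's lemma yields a pointwise minimal functional. *)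
pose r (s t : T) := `[< forall u, sval t u <= sval s u >].
have [|s t u /asboolP st /asboolP tu|s t /asboolP st /asboolP ts|A Atot|t tmin]
    := @Zorn T r.
- by move=> t; apply/asboolP.
- by apply/asboolP => v; exact: le_trans (tu v) (st v).
- case: s t st ts => [s ps] [t pt] /= st ts.
  apply: eq_exist; apply/funext => u; apply/le_anti.
  by rewrite st ts.
- pose G := [set sval t | t in A].
  have Gp : forall g, G g -> forall u, - p (- u) <= g u.
    move=> _ [[t [st tp]] At <-] u /=.
    by rewrite (le_trans _ (sublinear_geN u st))// lerN2.
  have [[t0 At0]|A0] := pselect (A !=set0); last first.
    exists (exist _ p (conj sp (fun u => lexx (p u))) : T) => s As.
    by exfalso; apply: A0; exists s.
  have sG : sublinear (pointwise_inf G).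
    apply: pointwise_inf_sublinear Gp _ _.
    + by exists (sval t0); exists t0.
    + move=> _ _ [s As <-] [t At <-].
      have [/asboolP st|/asboolP ts] := Atot _ _ As At.
        exists (sval t); first by exists t.
        move=> u v; apply: le_trans ((svalP t).1.1 _ _) _.
        by rewrite lerD2r.
      exists (sval s); first by exists s.
      move=> u v; apply: le_trans ((svalP s).1.1 _ _) _.
      by rewrite lerD2l.
    + move=> _ a [t At <-] a0; exists (sval t); first by exists t.
      by move=> u; exact: ((svalP t).1.2 _ _ a0).
  have Gle u : pointwise_inf G u <= p u.
    apply: le_trans (_ : sval t0 u <= _); last exact: (svalP t0).2.
    by apply: pointwise_inf_le Gp _; exists t0.
  pose t1 : T := exist _ (pointwise_inf G) (conj sG Gle).
  exists t1 => s As; apply/asboolP => u /=.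
  by apply: pointwise_inf_le Gp _; exists s.
- exists (sval t); have [st tp] := svalP t; split=> // q sq qt.
  have qp u : q u <= p u by exact: le_trans (qt u) (tp u).
  pose t1 : T := exist _ q (conj sq qp).
  by have /(congr1 sval) : t1 = t by apply: tmin; apply/asboolP.
Qed.

(* A minimal sublinear functional is linear: by [sublinear_lower] it is odd. *)
Lemma hahn_banach p w : sublinear p ->
  exists g : V -> R, [/\ linear (g : V -> R^o), forall u, g u <= p u & g w = p w].
Proof.
(* Lowering at [w] before minimizing fixes the final value there: a linear q below p' has - q(w) =
   q(- w) <= - p(w). *)
move=> sp; have [p' [sp' p'p p'w]] := sublinear_lower w sp.
have [q [sq qp' qmin]] := sublinear_minimal sp'.
have qN u : q (- u) = - q u.
  have [q' [sq' q'q q'u]] := sublinear_lower u sq.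
  rewrite (qmin _ sq' q'q) in q'u.
  by apply/le_anti; rewrite q'u/= lerNl (le_trans (sublinear_geN u sq)).
have qD u v : q (u + v) = q u + q v.
  apply/le_anti; rewrite sq.1/=.
  have := sq.1 (- u) (- v); rewrite -opprD !qN; lra.
have qZ a u : q (a *: u) = a * q u.
  have [a0|a0|->] := ltrgtP a 0; last by rewrite scale0r mul0r sublinear0.
    rewrite -[a]opprK scaleNr qN sublinearZ ?oppr_gt0//; ring.
  exact: sublinearZ.
exists q; split=> [a u v|u|]; first by rewrite qD qZ.
  exact: le_trans (qp' u) (p'p u).
apply/le_anti; rewrite (le_trans (qp' w) (p'p w))/=.
have := le_trans (qp' (- w)) p'w; rewrite qN; lra.
Qed.

End HahnBanach.

(** Together with [has_nonneg_sups], this is what the proof takes from the completeness of the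
    scalars; establishing both for [R] and [R[i]] lets one argument over [K] cover the two cases. *)
Definition has_norming_functionals (K : numFieldType) :=
  forall (X : normedModType K) (w : X), exists phi : {linear X -> K^o},
    (forall v, `|phi v| <= `|v|) /\ `|w| <= `|phi w|.

Definition has_nonneg_sups (K : numFieldType) := forall A : set K,
  A !=set0 -> (forall a, A a -> 0 <= a) -> (exists M, ubound A M) ->
  exists s, supremums A s.

Lemma real_nonneg_sups (R : realType) : has_nonneg_sups R.
Proof.
move=> A A0 _ [M AM]; exists (sup A); split.
  by apply: ub_le_sup; exists M.
by move=> y Ay; exact: ge_sup.
Qed.

Lemma linear_pack (K : numFieldType) (X W : lmodType K) (g : X -> W) :
  linear g -> exists phi : {linear X -> W}, phi =1 g.
Proof.
move=> gl; pose L := GRing.isLinear.Build K X W *:%R g gl.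
by exists (HB.pack_for {linear X -> W} g L).
Qed.

Lemma real_norming_functionals (R : realType) : has_norming_functionals R.
Proof.
move=> X w.
have sn : sublinear (fun v : X => `|v|).
  split=> [u v|a u a0]; first exact: ler_normD.
  by rewrite normrZ gtr0_norm.
have [g [gl gn gw]] := hahn_banach w sn.
have [phi phiE] := linear_pack gl.
exists phi; split=> [v|]; last by rewrite phiE gw ger0_norm.
rewrite phiE ler_norml gn andbT lerNl.
have := gl (-1) v 0; rewrite !addr0 !scaleN1r.
have -> : g 0 = 0 by have := gl 1 0 0; rewrite !scale1r addr0; lra.
by rewrite addr0 => <-; rewrite -[leRHS]normrN.
Qed.

(** * Complex scalars, by restriction to the real ones *)

Section Complex.
Variable R : realType.
Local Notation C := R[i].

(** A separate name for the carrier, so that the real scalar action gets its own instance next to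
    the complex one. *)
Definition realified (X : lmodType C) : Type := X.
HB.instance Definition _ (X : lmodType C) := GRing.Zmodule.on (realified X).

Section Realified.
Variable X : lmodType C.
Definition realified_scale (a : R) (x : realified X) : realified X :=
  (a%:C%C : C) *: (x : X).

Fact realified_scaleA a b x :
  realified_scale a (realified_scale b x) = realified_scale (a * b) x.
Proof. by rewrite /realified_scale scalerA rmorphM. Qed.
Fact realified_scale1 : left_id 1 realified_scale.
Proof. by move=> x; rewrite /realified_scale rmorph1 scale1r. Qed.
Fact realified_scaleDr : right_distributive realified_scale +%R.
Proof. by move=> a x y; rewrite /realified_scale scalerDr. Qed.
Fact realified_scaleDl x : {morph realified_scale^~ x : a b / a + b}.
Proof. by move=> a b; rewrite /realified_scale rmorphD scalerDl. Qed.

HB.instance Definition _ := GRing.Zmodule_isLmodule.Build R (realified X)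
  realified_scaleA realified_scale1 realified_scaleDr realified_scaleDl.
End Realified.

Lemma complex_ge0 (z : C) : 0 <= z -> z = ((complex.Re z)%:C)%C.
Proof. by case: z => a b; rewrite lecE/= => /andP[/eqP -> _]. Qed.

(** Comparison with a nonnegative element forces an upper bound to be real, so suprema are computed
    on real parts. *)
Lemma complex_nonneg_sups : has_nonneg_sups C.
Proof.
move=> A [a Aa] A0 [M AM].
have AE b : A b -> b = ((complex.Re b)%:C)%C by move=> /A0/complex_ge0.
have ubE z : ubound A z <->
    complex.Im z = 0 /\ ubound (@complex.Re R @` A) (complex.Re z).
  split=> [Az|[z0 Az] b Ab].
    have az := Az _ Aa; have := le_trans (A0 _ Aa) az.
    move=> /complex_ge0 zE; split; first by rewrite zE.
    move=> _ [b Ab <-]; have := Az _ Ab; rewrite (AE _ Ab) zE lecE/=.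
    by move=> /andP[].
  by rewrite (AE _ Ab) lecE/= z0 eqxx/=; apply: Az; exists b.
have [s [s1 s2]] : exists s, supremums (@complex.Re R @` A) s.
  apply: real_nonneg_sups.
  - by exists (complex.Re a); exists a.
  - by move=> _ [b Ab <-]; have := A0 _ Ab; rewrite (AE _ Ab) lecE/= => /andP[].
  - by exists (complex.Re M); exact: ((ubE M).1 AM).2.
exists (s%:C)%C; split; first by apply/ubE.
move=> z /ubE[z0 zA]; rewrite lecE/= z0 eqxx/=; exact: s2.
Qed.

(* A unit scalar [u] rotates [phi v] to a nonnegative real, where [phi] agrees
   with its real part [g]. *)
Lemma complex_norming_functionals : has_norming_functionals C.
Proof.
move=> X w; pose p (v : realified X) : R := complex.Re `|v : X|.
have pE (v : X) : `|v| = ((p v)%:C)%C by exact: complex_ge0.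
have sp : sublinear p.
  split=> [u v|a u a0].
    by have := ler_normD (u : X) v; rewrite !pE -rmorphD lecR.
  rewrite -lecR -pE [leLHS]normrZ pE ger0_norm; last by rewrite ler0c ltW.
  by rewrite rmorphM.
have [g [gl gp gw]] := hahn_banach (w : realified X) sp.
have gD (u v : X) : g (u + v) = g u + g v.
  by have := gl 1 u v; rewrite !scale1r.
have gZ a (u : X) : g (((a%:C)%C : C) *: u) = a * g u.
  have g0 : g 0 = 0 by have := gl 1 0 0; rewrite !scale1r addr0; lra.
  by have := gl a u 0; rewrite g0 !addr0.
(* The only complex-linear functional with real part [g]. *)
pose f (v : X) : C := (g v +i* - g ('i%C *: v))%C.
have fl : linear (f : X -> C^o).
  move=> [a b] u v.
  have abE : (a +i* b)%C = (a%:C)%C + (b%:C)%C * 'i%C :> C.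
    by apply/eqP; rewrite eq_complex/=; apply/andP; split; apply/eqP; ring.
  have iE : 'i%C * (a +i* b)%C = (a%:C)%C * 'i%C + ((- b)%:C)%C :> C.
    by apply/eqP; rewrite eq_complex/=; apply/andP; split; apply/eqP; ring.
  rewrite /f scalerDr scalerA iE abE !scalerDl !gD -!scalerA !gZ.
  apply/eqP; rewrite eq_complex/=; apply/andP; split; apply/eqP; ring.
have [phi phiE] := linear_pack fl.
have phi_le v : `|phi v| <= `|v|.
  have [/eqP|z0] := eqVneq (phi v) 0; first by rewrite -normr_eq0 => /eqP ->.
  pose u : C := `|phi v| / phi v.
  have u1 : `|u| = 1 by rewrite normrM normfV normr_id divff// normr_eq0.
  have fu : f (u *: v) = `|phi v|.
    by rewrite -phiE linearZ/= /GRing.scale/= divfK.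
  have fE : `|phi v| = ((g (u *: v))%:C)%C by rewrite [LHS]complex_ge0// -fu.
  have <- : `|u *: v| = `|v| by rewrite normrZ u1 mul1r.
  by rewrite fE pE lecR.
exists phi; split=> //.
rewrite phiE pE; rewrite -gw.
by apply: le_trans (normc_ge_Re _); rewrite lecR ler_norm.
Qed.
End Complex.

(** * Polarization *)

Section Multilinear.
Variables (K : numFieldType) (X W : lmodType K) (d : nat).
Variable f : ('I_d -> X) -> W.
Hypothesis fM : multilinear f.

Lemma dfwithE (x : 'I_d -> X) i u :
  dfwith x i u = fun j => if j == i then u else x j.
Proof.
apply/funext => j; case: eqVneq => [->|ji]; first by rewrite dfwithin.
by rewrite dfwithout// eq_sym.
Qed.

Lemma multilinear_linear (x : 'I_d -> X) i :
  exists phi : {linear X -> W}, phi =1 (fun u => f (dfwith x i u)).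
Proof. by apply: linear_pack => a u v; rewrite fM. Qed.

Lemma multilinear_scale (a : 'I_d -> K) (x : 'I_d -> X) :
  f (fun i => a i *: x i) = (\prod_i a i) *: f x.
Proof.
suff h (s : seq 'I_d) : uniq s ->
    f (fun i => if i \in s then a i *: x i else x i) = (\prod_(i <- s) a i) *: f x.
  have := h _ (index_enum_uniq 'I_d) => <-; congr f.
  by apply/funext => i; rewrite mem_index_enum.
elim: s => [_|i s IH /= /andP[is_ us]]; first by rewrite big_nil scale1r.
pose y j := if j \in s then a j *: x j else x j.
have [phi phiE] := multilinear_linear y i.
have -> : (fun j => if j \in i :: s then a j *: x j else x j)
    = dfwith y i (a i *: x i).
  by rewrite dfwithE; apply/funext => j; rewrite inE; case: eqVneq => [->|].
rewrite -phiE linearZ/= phiE big_cons -scalerA -IH//; congr (_ *: f _).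
rewrite dfwithE; apply/funext => j; case: eqVneq => [->|//].
by rewrite (negbTE is_).
Qed.

Lemma multilinear_diag0 : (0 < d)%N -> f (fun=> 0) = 0.
Proof.
move=> d0; have -> : (fun=> 0) = fun _ : 'I_d => 0 *: 0 :> X.
  by apply/funext => i; rewrite scaler0.
by rewrite multilinear_scale prodr_const card_ord expr0n gtn_eqF// scale0r.
Qed.

(** Slots outside [s] stay frozen at [j0], so the terms are indexed by the choice functions equal to
    [j0] off [s]. A partial list of slots serves the induction, and later the expansion of all slots
    but one. *)
Lemma multilinear_expand (J : finType) (j0 : J) (v : 'I_d -> J -> X)
    (s : seq 'I_d) : uniq s ->
  f (fun i => if i \in s then \sum_j v i j else v i j0)
    = \sum_(k in pffun_on j0 (mem s) predT) f (fun i => v i (k i)).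
Proof.
elim: s v => [|i s IH] v /=.
  move=> _; rewrite (big_pred1 [ffun=> j0]).
    by congr f; apply/funext => i; rewrite ffunE.
  move=> k; apply/pffun_onP/eqP => [[/fintype.subsetP k0 _]|->].
    apply/ffunP => i; rewrite ffunE; apply/eqP/negPn/negP => ki.
    by have := k0 i ki.
  split=> //; apply/fintype.subsetP => i; by rewrite inE ffunE eqxx.
move=> /andP[is_ us].
pose y j := if j \in s then \sum_l v j l else v j j0.
have [phi phiE] := multilinear_linear y i.
have -> : (fun j => if j \in i :: s then \sum_l v j l else v j j0)
    = dfwith y i (\sum_l v i l).
  by rewrite dfwithE; apply/funext => j; rewrite inE; case: eqVneq => [->|].
rewrite -phiE linear_sum.
(* [v' l] is constantly [v i l] in slot [i], so the induction hypothesis applies although that slot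
   is outside [s]. *)
pose v' l j m := if j == i then v i l else v j m.
transitivity (\sum_l \sum_(k in pffun_on j0 (mem s) predT)
    f (fun j => v' l j (k j))).
  apply: eq_bigr => l _; rewrite phiE -IH//; congr f; rewrite dfwithE.
  apply/funext => j; rewrite /v' /y; case: eqVneq => [->|//].
  by rewrite (negbTE is_).
rewrite pair_big_dep/=.
pose h (lk : J * {ffun 'I_d -> J}) := [ffun j => if j == i then lk.1 else lk.2 j].
pose h' (k : {ffun 'I_d -> J}) := (k i, [ffun j => if j == i then j0 else k j]).
rewrite [RHS](reindex_onto h h'); last first.
  move=> k _; apply/ffunP => j; rewrite !ffunE/=.
  by case: eqVneq => [->|].
apply: eq_big => [[l k]/=|[l k] _]; last first.
  by congr f; apply/funext => j; rewrite /v' ffunE/=; case: eqVneq => // ->.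
apply/idP/andP
    => [/pffun_onP[/fintype.subsetP k0 _]|[/pffun_onP[/fintype.subsetP k0 _]]].
  split.
    apply/pffun_onP; split=> //; apply/fintype.subsetP => j; rewrite !inE ffunE/=.
    by case: (eqVneq j i) => //= ji; have := k0 j; rewrite !inE.
  rewrite /h' !ffunE eqxx/=; apply/eqP; congr pair; apply/ffunP => j.
  rewrite !ffunE/=; case: eqVneq => // ->.
  by apply/esym/eqP/negPn/negP => ki; have := k0 i ki; exact/negP.
rewrite /h' => /eqP[_ /ffunP kE]; apply/pffun_onP; split => //.
apply/fintype.subsetP => j; rewrite inE => kj.
have ji : j != i by apply: contra kj => /eqP ->; rewrite -kE ffunE eqxx.
by have := k0 j; rewrite !inE ffunE (negbTE ji)/=; apply.
Qed.

Lemma multilinear_sum (J : finType) (j0 : J) (v : 'I_d -> J -> X) :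
  f (fun i => \sum_j v i j) = \sum_(k : {ffun 'I_d -> J}) f (fun i => v i (k i)).
Proof.
transitivity (f (fun i => if i \in enum 'I_d then \sum_j v i j else v i j0)).
  by congr f; apply/funext => i; rewrite mem_enum.
rewrite multilinear_expand ?enum_uniq//; apply: eq_bigl => k.
apply/pffun_onP; split=> //; apply/fintype.subsetP => i _.
by rewrite -[_ \in _]/(i \in enum _) mem_enum.
Qed.

Definition symmetrization (x : 'I_d -> X) : W :=
  (d`!%:R)^-1 *: \sum_(s : 'S_d) f (fun i => x (s i)).

Lemma symmetrization_multilinear : multilinear symmetrization.
Proof.
move=> x i a u v; rewrite /symmetrization scalerA mulrC -scalerA -scalerDr.
congr (_ *: _); rewrite scaler_sumr -big_split/=; apply: eq_bigr => s _.
have E w : (fun j => dfwith x i w (s j)) = dfwith (x \o s) ((s^-1)%g i) w.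
  rewrite !dfwithE; apply/funext => j /=.
  by rewrite -[in RHS](inj_eq (@perm_inj _ s)) permKV.
by rewrite !E fM.
Qed.

Lemma symmetrization_diag z : symmetrization (fun=> z) = f (fun=> z).
Proof.
rewrite /symmetrization sumr_const card_Sn -[X in _ *: X]scaler_nat scalerA.
rewrite mulVf ?scale1r//.
by rewrite pnatr_eq0 -lt0n fact_gt0.
Qed.

Local Notation sgn b := ((-1) ^+ nat_of_bool b : K).

(* If [k] misses [j], changing the sign [e j] changes the sign of each term. *)
Lemma sum_signs (k : {ffun 'I_d -> 'I_d}) :
  \sum_(e : {ffun 'I_d -> bool}) (\prod_i sgn (e i)) * \prod_i sgn (e (k i))
    = ((2 ^ d)%N * injectiveb k)%:R.
Proof.
case: (boolP (injectiveb k)) => [/injectiveP k_inj|k_ninj].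
  rewrite muln1 -[in RHS](card_ord d) -card_bool -card_ffun -sumr_const.
  apply: eq_bigr => e _; rewrite [X in _ * X](_ : _ = \prod_i sgn (e i)).
    by rewrite -big_split big1// => i _ /=; rewrite -expr2 sqrr_sign.
  by rewrite [RHS](reindex_inj k_inj).
have [j jk] : exists j, j \notin codom k.
  apply/existsP; rewrite -negb_forall; apply: contra k_ninj => /forallP all_k.
  apply/injectiveP => a b; apply: (image_injP (A := predT)) => //.
  by apply/eqP/eq_card => i; rewrite all_k.
rewrite muln0.
pose h (e : {ffun 'I_d -> bool}) := [ffun i => (i == j) (+) e i].
have hK : involutive h by move=> e; apply/ffunP => i; rewrite !ffunE addKb.
set S := LHS.
suff : S = - S by move/eqP; rewrite -addr_eq0 -mulr2n mulrn_eq0 => /eqP.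
rewrite /S [LHS](reindex_inj (inv_inj hK))/= -sumrN; apply: eq_bigr => e _.
rewrite -mulNr; congr (_ * _); last first.
  apply: eq_bigr => i _; rewrite ffunE (_ : _ == _ = false)//.
  by apply/eqP => ki; case/negP: jk; rewrite -ki codom_f.
rewrite (bigD1 j)//= [in RHS](bigD1 j)//= ffunE eqxx -mulNr.
congr (_ * _); first by case: (e j); rewrite ?expr0 ?expr1 ?opprK.
by apply: eq_bigr => i /negbTE ij; rewrite ffunE ij.
Qed.

(** Expanding each diagonal value gives multiples of f(x o k). Summed over all signs, the terms with
    k not injective cancel by [sum_signs], and every permutation is counted 2^d times. *)
Lemma polarization (x : 'I_d -> X) : (0 < d)%N ->
  symmetrization x = ((2 ^ d * d`!)%N%:R)^-1 *:
    \sum_(e : {ffun 'I_d -> bool})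
      (\prod_i sgn (e i)) *: f (fun=> \sum_j sgn (e j) *: x j).
Proof.
move=> d0.
rewrite /symmetrization natrM invfM mulrC -scalerA; congr (_ *: _).
apply: (scalerI (a := (2 ^ d)%N%:R)).
  by rewrite pnatr_eq0 -lt0n expn_gt0.
rewrite [in RHS]scalerA divff ?scale1r ?pnatr_eq0 -?lt0n ?expn_gt0//.
transitivity (\sum_(e : {ffun 'I_d -> bool}) \sum_(k : {ffun 'I_d -> 'I_d})
    (\prod_i sgn (e i) * \prod_i sgn (e (k i))) *: f (x \o k)); last first.
  apply: eq_bigr => e _; rewrite (multilinear_sum (Ordinal d0)) scaler_sumr.
  apply: eq_bigr => k _.
  by rewrite (multilinear_scale (fun i => sgn (e (k i))) (x \o k)) scalerA.
rewrite exchange_big/=.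
under [in RHS]eq_bigr => k _ do rewrite -scaler_suml sum_signs.
rewrite (bigID (fun k : {ffun 'I_d -> 'I_d} => injectiveb k))/=.
rewrite [X in _ + X]big1 => [|k /negbTE ->]; last by rewrite muln0 scale0r.
rewrite addr0 scaler_sumr [RHS](reindex (@pval _)) /=; last first.
  pose in_Sn := insubd (1%g : 'S_d).
  by exists in_Sn => /= k Uk; first apply: val_inj; apply: insubdK.
apply: eq_big => [s|s _]; first by rewrite (valP s).
by rewrite (valP s) muln1; congr (_ *: f _); apply/funext => i /=; rewrite pvalE.
Qed.

End Multilinear.

(** * Suprema and infima of nonnegative scalars *)

Section NonnegBounds.
Variable K : numFieldType.
Hypothesis supK : has_nonneg_sups K.

Lemma supremum_lub (A : set K) : A !=set0 -> (forall a, A a -> 0 <= a) ->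
  (exists M, ubound A M) -> supremums A (supremum 0 A).
Proof.
move=> A0 Age0 AM; rewrite /supremum ifF; last exact/negbTE/set0P.
by apply: xgetPex; exact: supK.
Qed.

(** The infimum is obtained as the supremum of the nonnegative lower bounds. *)
Lemma infimum_glb (A : set K) : A !=set0 -> (forall a, A a -> 0 <= a) ->
  infimums A (infimum 0 A).
Proof.
move=> A0 Age0; rewrite /infimum ifF; last exact/negbTE/set0P.
apply: xgetPex; have [a Aa] := A0.
have [s [s1 s2]] : exists s, supremums [set b | 0 <= b /\ lbound A b] s.
  by apply: supK; [exists 0|move=> b []|exists a => b [_]; exact].
exists s; split=> [c Ac|l lA]; first by apply: s2 => b [_]; exact.
(* A lower bound is comparable with a nonnegative element, hence real; a negative one lies below [s]
   anyway. *)
have lr : l \is Num.real by rewrite (ler_real (lA _ Aa)) ger0_real ?Age0.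
have [l0|/ltW l0] := real_leP (real0 K) lr; first exact: s1.
by apply: le_trans l0 (s1 _ _).
Qed.

Section SupNorm.
Variables (X Y : normedModType K) (f : X -> Y).

Lemma sup_norm_lub (c : K) : (forall x, `|x| <= 1 -> `|f x| <= c) ->
  supremums [set `|f x| | x in [set x : X | `|x| <= 1]] (sup_norm f).
Proof.
move=> fc; apply: supremum_lub.
- by exists `|f 0|; exists 0 => //=; rewrite normr0.
- by move=> _ [x _ <-].
- by exists c => _ [x x1 <-]; exact: fc.
Qed.

Lemma sup_norm_le c : (forall x, `|x| <= 1 -> `|f x| <= c) -> sup_norm f <= c.
Proof. by move=> fc; apply: (sup_norm_lub fc).2 => _ [x x1 <-]; exact: fc. Qed.

Lemma le_sup_norm c x : (forall x, `|x| <= 1 -> `|f x| <= c) -> `|x| <= 1 ->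
  `|f x| <= sup_norm f.
Proof. by move=> fc x1; apply: (sup_norm_lub fc).1; exists x. Qed.
End SupNorm.

Section LipConst.
Variables (S : Type) (Y : normedModType K) (dist : S -> S -> K) (f : S -> Y).

Lemma lip_const_glb : lipschitz_map dist f ->
  infimums (lipschitz_bounds dist f) (lip_const dist f).
Proof. by move=> fl; apply: infimum_glb => // L []. Qed.

Lemma lip_const_le L : lipschitz_bounds dist f L -> lip_const dist f <= L.
Proof. by move=> fL; apply: (lip_const_glb _).1 => //; exists L. Qed.

Lemma le_lip_const c : lipschitz_map dist f ->
  (forall L, lipschitz_bounds dist f L -> c <= L) -> c <= lip_const dist f.
Proof. by move=> fl fc; exact: (lip_const_glb fl).2. Qed.
End LipConst.

End NonnegBounds.

(** Replaces letting c tend to 1. In the inductive step the hypothesis at the smaller of c and e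
    gives A <= e^m (c B) for every e > 1, hence A <= c B. *)
Lemma ler_expn_gt1 (K : numFieldType) (m : nat) (A B : K) : 0 <= A -> 0 <= B ->
  (forall c, 1 < c -> A <= c ^+ m * B) -> A <= B.
Proof.
move=> A0; elim: m B => [|m IH] B B0 AB.
  by have := AB 2; rewrite ltr1n => /(_ isT); rewrite mul1r.
have cle c : 1 < c -> A <= c * B.
  move=> c1; have c0 : 0 <= c by rewrite (le_trans ler01)// ltW.
  apply: IH => [|e e1]; first exact: mulr_ge0.
  have e0 : 0 <= e by rewrite (le_trans ler01)// ltW.
  have cr : c \is Num.real by exact: ger0_real.
  have er : e \is Num.real by exact: ger0_real.
  have [ce|ec] := real_leP cr er.
    apply: le_trans (AB _ c1) _; rewrite exprSr -mulrA ler_wpM2r ?mulr_ge0//.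
    by rewrite lerXn2r.
  apply: le_trans (AB _ e1) _; rewrite exprSr -mulrA ler_wpM2l ?exprn_ge0//.
  by rewrite ler_wpM2r// ltW.
have [|BA] := real_leP (ger0_real A0) (ger0_real B0); first by [].
have [B_0|Bn0] := eqVneq B 0.
  by have := AB 2; rewrite ltr1n B_0 mulr0 -B_0 (lt_geF BA) => /(_ isT).
have Bp : 0 < B by rewrite lt_def Bn0.
(* This c is chosen so that c B is the mean of A and B, which is below A if B < A. *)
pose c := (1 + A / B) / 2.
have c1 : 1 < c.
  by rewrite ltr_pdivlMr// mul1r -[2]/(1 + 1) ltrD2l ltr_pdivlMr ?mul1r.
have cB : c * B = (B + A) / 2 by rewrite /c; field.
have := cle c c1; rewrite cB ler_pdivlMr// mulr_natr mulr2n.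
by rewrite lerD2r (lt_geF BA).
Qed.

(** * Comparison with reasonable cross norms *)

Lemma functional_sub (K : numFieldType) (X : lmodType K)
    (phi : {linear X -> K^o}) a b u v :
  phi (a *: u - b *: v) = a * phi u - b * phi v :> K.
Proof. by rewrite linearB; congr (_ - _); exact: linearZ. Qed.

(** Cramer's rule: [a], [b] and [p], [q] stand for the values of two functionals at [x], [y], [r]
    for the inverse determinant, and [m], [n] for their values at the vector to be expanded. *)
Lemma scale_cramer (K : comNzRingType) (X : lmodType K)
    (a b p q r m n : K) (x y : X) :
  m *: (r *: (q *: x - p *: y)) + n *: (r *: (a *: y - b *: x)) =
    (r * (m * q - n * b)) *: x + (r * (n * a - m * p)) *: y.
Proof.
rewrite !scalerBr !scalerA [X in _ + X]addrC addrACA -scalerBl.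
by rewrite [X in _ + X = _]addrC -scalerBl; congr (_ *: _ + _ *: _); ring.
Qed.

(** * Approximate Auerbach bases *)

Section Auerbach.
Variable K : numFieldType.
Hypothesis supK : has_nonneg_sups K.
Hypothesis normK : has_norming_functionals K.
Variable X : normedModType K.

(* [f] and [g] almost maximize the determinant [D] among unit functionals. A
   vector [a] of the dual basis then has norm at most [c]: if [phi] norms [a],
   [phi a] is [D] with [f] or [g] replaced by [phi], divided by [D f g]. *)
Lemma approximate_auerbach (c : K) (x y : X) : 1 < c ->
  exists (e : bool -> X) (g : bool -> {linear X -> K^o}),
    [/\ forall b, `|e b| <= c, forall b v, `|g b v| <= `|v|,
      x = \sum_b g b x *: e b & y = \sum_b g b y *: e b].
Proof.
move=> c1; have c0 : 0 < c by exact: lt_trans ltr01 c1.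
pose D (f g : {linear X -> K^o}) : K := f x * g y - f y * g x.
pose A := [set a : K | exists f g : {linear X -> K^o},
  [/\ forall v, `|f v| <= `|v|, forall v, `|g v| <= `|v| & a = `|D f g|]].
have [s [s1 s2]] : exists s, supremums A s.
  apply: supK.
  - have [phi [phi1 _]] := normK x.
    by exists `|D phi phi|; exists phi, phi.
  - by move=> _ [f [g [_ _ ->]]].
  - exists (`|x| * `|y| + `|y| * `|x|) => _ [f [g [f1 g1 ->]]].
    by rewrite (le_trans (ler_normB _ _))// !normrM lerD// ler_pM.
have DA (f g : {linear X -> K^o}) : (forall v, `|f v| <= `|v|) ->
    (forall v, `|g v| <= `|v|) ->
    `|D f g| <= s by move=> f1 g1; apply: s1; exists f, g.
have DE (f g : {linear X -> K^o}) : f (g y *: x - g x *: y) = D f g.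
  by rewrite functional_sub /D mulrC [g x * _]mulrC.
have s0 : 0 <= s.
  by have [phi [phi1 _]] := normK x; exact: le_trans (DA _ _ phi1 phi1).
(* If all determinants vanish, [x] and [y] are parallel, and a single vector completed by 0 takes
   the place of the basis. *)
have [sE|sn0] := eqVneq s 0.
  have dep (z : X) (phi : {linear X -> K^o}) : `|z| <= `|phi z| ->
      phi z *: ((phi z)^-1 *: z) = z.
    move=> zphi; rewrite scalerA; have [pz|pz] := eqVneq (phi z) 0; last first.
      by rewrite divff// scale1r.
    by move: zphi; rewrite pz normr0 normr_le0 => /eqP ->; rewrite scaler0.
  (* The value of a norming functional at [phi y *: x - phi x *: y] is a determinant, so this vector
     is 0. *)
  have parallel (phi : {linear X -> K^o}) : (forall v, `|phi v| <= `|v|) ->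
      phi y *: x = phi x *: y.
    move=> phi1; apply/eqP; rewrite -subr_eq0 -normr_le0.
    have [g [g1 gw]] := normK (phi y *: x - phi x *: y).
    by rewrite -sE (le_trans gw)// DE DA.
  have bound (z : X) (phi : {linear X -> K^o}) : `|z| <= `|phi z| ->
      `|(phi z)^-1 *: z| <= c.
    move=> zphi; rewrite normrZ normfV.
    have [->|pz] := eqVneq (phi z) 0; first by rewrite normr0 invr0 mul0r ltW.
    by rewrite ler_pdivrMl ?normr_gt0// (le_trans zphi)// ler_peMr// ltW.
  have [y0|y0] := eqVneq y 0.
    have [phi [phi1 phix]] := normK x.
    exists (fun b => if b then (phi x)^-1 *: x else 0), (fun=> phi).
    split=> [[]|//||]; rewrite ?big_bool/= ?scaler0 ?addr0 ?dep//.
    - exact: bound.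
    - by rewrite normr0 ltW.
    - by rewrite y0 linear0 scale0r.
  have [phi [phi1 phiy]] := normK y.
  exists (fun b => if b then (phi y)^-1 *: y else 0), (fun=> phi).
  split=> [[]|//||]; rewrite ?big_bool/= ?scaler0 ?addr0 ?dep//.
  - exact: bound.
  - by rewrite normr0 ltW.
  - have py : phi y != 0.
      by apply: contra y0 => /eqP py; move: phiy; rewrite py normr0 normr_le0.
    by rewrite scalerA mulrC -scalerA -parallel// scalerA mulVf ?scale1r.
have sp : 0 < s by rewrite lt_def sn0.
have [f [g [f1 g1 fg]]] : exists f g : {linear X -> K^o},
    [/\ forall v, `|f v| <= `|v|, forall v, `|g v| <= `|v| & s <= c * `|D f g|].
  apply/not_existsP => /= h.
  (* Without a near-maximizing pair, [s / c] would bound all determinants, against the minimality of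
     [s]. *)
  have : s <= s / c.
    apply: s2 => _ [f [g [f1 g1 ->]]]; rewrite ler_pdivlMr// mulrC.
    have cD : c * `|D f g| \is Num.real by rewrite ger0_real// mulr_ge0// ltW.
    have [//|/ltW h'] := real_leP cD (ger0_real s0).
    by exfalso; apply: (h f); exists g.
  by rewrite ler_pdivlMr// ger_pMr// (lt_geF c1).
have Dn0 : D f g != 0.
  by apply/eqP => D0; move: fg; rewrite D0 normr0 mulr0 (lt_geF sp).
have cramer (a : X) : (forall phi : {linear X -> K^o},
    (forall v, `|phi v| <= `|v|) -> `|phi a| <= s) -> `|(D f g)^-1 *: a| <= c.
  move=> h; have [phi [phi1 phia]] := normK a.
  rewrite normrZ normfV ler_pdivrMl ?normr_gt0// mulrC.
  exact: le_trans phia (le_trans (h _ phi1) fg).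
exists (fun b => (D f g)^-1 *:
      if b then g y *: x - g x *: y else f x *: y - f y *: x),
  (fun b => if b then f else g); split.
- case; apply: cramer => phi phi1; first by rewrite DE DA.
  by rewrite -opprB linearN DE normrN DA.
- by case.
- rewrite big_bool/= scale_cramer /D [g x * _]mulrC [g x * f x]mulrC subrr mulVf//.
  by rewrite scale1r mulr0 scale0r addr0.
- rewrite big_bool/= scale_cramer /D [g y * _]mulrC subrr [g y * _]mulrC mulVf//.
  by rewrite mulr0 scale0r scale1r add0r.
Qed.
End Auerbach.

Lemma norm1_functional_continuous (K : numFieldType) (X : normedModType K)
    (phi : {linear X -> K^o}) :
  (forall v, `|phi v| <= `|v|) -> continuous phi.
Proof.
move=> phi1; apply: bounded_linear_continuous; apply/bounded_funP => r.
by exists r => v; exact: le_trans.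
Qed.

Lemma prod_functionals_multilinear (K : numFieldType) (X : lmodType K) (d : nat)
    (phi : 'I_d -> {linear X -> K^o}) :
  multilinear (fun x : 'I_d -> X => \prod_(i < d) phi i (x i) : K^o).
Proof.
move=> x i a u v.
have E w : \prod_(j < d) phi j (dfwith x i w j)
    = phi i w * \prod_(j < d | j != i) phi j (x j) :> K.
  rewrite (bigD1 i)//= dfwithin; congr (_ * _).
  by apply: eq_bigr => j ji; rewrite dfwithout// eq_sym.
by rewrite !E linearP mulrDl; congr (_ + _); rewrite /GRing.scale/= mulrA.
Qed.

(** * Bounds for multilinear maps from their diagonal *)

Section MultilinearBounds.
Variables (K : numFieldType) (X Y : normedModType K) (d : nat).
Variables (f : ('I_d -> X) -> Y) (s : K).
Hypothesis fM : multilinear f.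
Hypothesis f1 : forall z, `|z| <= 1 -> `|f (fun=> z)| <= s.

Lemma scale_norm_inv (z : X) : `|z| *: (`|z|^-1 *: z) = z.
Proof.
have [->|z0] := eqVneq z 0; first by rewrite !scaler0.
by rewrite scalerA mulfV ?scale1r// normr_eq0.
Qed.

Lemma norm_scale_norm_inv (z : X) : `| `|z|^-1 *: z | <= 1.
Proof.
rewrite normrZ normfV normr_id; have [->|z0] := eqVneq z 0.
  by rewrite normr0 mulr0 ler01.
by rewrite mulVf// normr_eq0.
Qed.

Lemma diag_bound z : `|f (fun=> z)| <= s * `|z| ^+ d.
Proof.
rewrite -{1}[z]scale_norm_inv (multilinear_scale fM) prodr_const card_ord.
rewrite normrZ normrX normr_id mulrC ler_wpM2r ?exprn_ge0// f1//.
exact: norm_scale_norm_inv.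
Qed.

(** By homogeneity the x_i may be taken in the unit ball. Each of the 2^d signed sums in
    [polarization] then has norm at most d, so its diagonal value is at most s d^d; dividing by 2^d
    d! gives the constant. *)
Lemma symmetrization_bound (x : 'I_d -> X) : (0 < d)%N ->
  `|symmetrization f x| <= (d ^ d)%N%:R / (d`!)%N%:R * s * \prod_i `|x i|.
Proof.
move=> d0; pose y i := `|x i|^-1 *: x i.
have -> : x = fun i => `|x i| *: y i by apply/funext => i; rewrite scale_norm_inv.
rewrite (multilinear_scale (symmetrization_multilinear fM)) normrZ.
have -> : \prod_i `| `|x i| *: y i| = \prod_i `|x i|.
  by apply: eq_bigr => i _; rewrite scale_norm_inv.
have s0 : 0 <= s by apply: le_trans (f1 (z := 0) _); rewrite ?normr0.
rewrite ger0_norm ?prodr_ge0// mulrC ler_wpM2r ?prodr_ge0//.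
rewrite (polarization fM)// normrZ normfV normr_nat ler_pdivrMl; last first.
  by rewrite ltr0n muln_gt0 expn_gt0 fact_gt0.
have -> : (2 ^ d * d`!)%N%:R * ((d ^ d)%N%:R / d`!%:R * s)
    = (2 ^ d)%N%:R * ((d ^ d)%N%:R * s) :> K.
  have : d`!%:R != 0 :> K by rewrite pnatr_eq0 -lt0n fact_gt0.
  by move=> ?; rewrite natrM; field.
apply: le_trans (ler_norm_sum _ _ _) _.
rewrite -[X in (2 ^ X)%N](card_ord d) -card_bool -card_ffun mulr_natl -sumr_const.
apply: ler_sum => e _; rewrite normrZ normr_prod big1 ?mul1r; last first.
  by move=> i _; rewrite normr_sign.
apply: le_trans (diag_bound _) _; rewrite mulrC ler_wpM2r// natrX lerXn2r ?nnegrE//.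
apply: le_trans (ler_norm_sum _ _ _) _.
rewrite -[X in _ <= X%:R](card_ord d) -sumr_const; apply: ler_sum => i _.
by rewrite normrZ normr_sign mul1r norm_scale_norm_inv.
Qed.

End MultilinearBounds.

(** * The Lipschitz estimate for a reasonable cross norm *)

Section ReasonableCrossNorm.
Variable K : numFieldType.
Hypothesis supK : has_nonneg_sups K.
Hypothesis normK : has_norming_functionals K.
Variables (X : normedModType K) (d : nat) (alpha : tensor X d -> K).
Hypothesis alphaP : reasonable_cross_norm alpha.

(** The tensor product of the phi_i is a functional of alpha-norm at most 1, here evaluated at x^d -
    y^d. *)
Lemma cross_norm_functionals (phi : 'I_d -> {linear X -> K^o}) (x y : X) :
  (forall i v, `|phi i v| <= `|v|) ->
  `|\prod_(i < d) phi i x - \prod_(i < d) phi i y : K|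
    <= alpha (tens (fun=> x) - tens (fun=> y)).
Proof.
move=> phi1; have [[alpha0 _ _ _] _ alphaF] := alphaP.
have phiM := prod_functionals_multilinear phi.
have := alphaF phi (fun i => norm1_functional_continuous (phi1 i))
  (tens (fun=> x) - tens (fun=> y)).
have [L LE] := linear_pack (tlift_linear phiM).
rewrite -LE linearB !LE !tlift_tens// => /le_trans; apply.
rewrite ler_piMl//; apply: prodr_ile1 => i _.
have phi11 v : `|v| <= 1 -> `|phi i v| <= 1 by exact: le_trans.
rewrite (sup_norm_le supK phi11) andbT.
by rewrite (le_trans _ (le_sup_norm supK phi11 (x := 0) _)) ?normr0.
Qed.

Lemma polynomial_cross_norm_bound (Y : normedModType K) (f : ('I_d -> X) -> Y)
    (s : K) (x y : X) : (0 < d)%N -> multilinear f ->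
  (forall z, `|z| <= 1 -> `|f (fun=> z)| <= s) ->
  `|f (fun=> x) - f (fun=> y)| <=
    (2 ^ d.-1 * d ^ d)%N%:R / (d`!)%N%:R * s *
      alpha (tens (fun=> x) - tens (fun=> y)).
Proof.
move=> d0 fM f1; have [[alpha0 _ _ _] _ _] := alphaP.
have s0 : 0 <= s by apply: le_trans (f1 0 _); rewrite ?normr0.
set a := alpha _; have a0 : 0 <= a by exact: alpha0.
set C := (d ^ d)%N%:R / (d`!)%N%:R * s.
have C0 : 0 <= C by rewrite mulr_ge0 ?divr_ge0.
have -> : (2 ^ d.-1 * d ^ d)%N%:R / (d`!)%N%:R * s * a = (2 ^ d.-1)%N%:R * (C * a).
  by rewrite /C natrM; ring.
(* The basis vectors are only bounded by c, which costs c^(d-1) over the d - 1 expanded slots; a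
   bound with this loss for every c > 1 suffices. *)
apply: (@ler_expn_gt1 _ d.-1) => // [|c c1]; first by rewrite mulr_ge0// mulr_ge0.
have [e [g [e1 g1 xE yE]]] := approximate_auerbach supK normK x y c1.
pose i0 := Ordinal d0; pose r := enum (predC1 i0).
pose F := symmetrization f; have FM : multilinear F := symmetrization_multilinear fM.
pose A := pffun_on true (mem r) (predT : pred bool).
pose E (k : {ffun 'I_d -> bool}) (i : 'I_d) := e (k i).
pose w (k : {ffun 'I_d -> bool}) z := (\prod_(i < d | i != i0) g (k i) z : K) *: z.
have expand z : z = \sum_b g b z *: e b ->
    f (fun=> z) = \sum_(k in A) F (dfwith (E k) i0 (w k z)).
  (* In slot [i0] nothing depends on [b], so its frozen value is [z] itself. *)
  move=> zE; pose v i b := if i == i0 then z else g b z *: e b.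
  rewrite -symmetrization_diag -/F.
  have -> : (fun=> z) = fun i => if i \in r then \sum_b v i b else v i true.
    apply/funext => i; rewrite mem_enum inE /v /=.
    by case: eqVneq => //= _; exact: zE.
  rewrite (multilinear_expand FM) ?enum_uniq//; apply: eq_bigr => k _.
  (* The coordinates are pulled out of the other slots and their product is put into slot [i0],
     which then holds [w k z]. *)
  pose h i : K := if i == i0 then 1 else g (k i) z.
  have -> : (fun i => v i (k i)) = fun i => h i *: dfwith (E k) i0 z i.
    apply/funext => i; rewrite dfwithE /v /h.
    by case: eqVneq => // _; rewrite scale1r.
  rewrite (multilinear_scale FM) (bigD1 i0)//= {1}/h eqxx mul1r.
  have [phi phiE] := multilinear_linear FM (E k) i0.
  rewrite -!phiE linearZ/=; congr (_ *: _); apply: eq_bigr => i /negbTE i_neq.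
  by rewrite /h i_neq.
rewrite (expand x xE) (expand y yE) -sumrB.
apply: le_trans (ler_norm_sum _ _ _) _.
(* [A] has 2^(d-1) elements: its functions are free on the d - 1 slots of [r] only. *)
have -> : c ^+ d.-1 * ((2 ^ d.-1)%N%:R * (C * a))
    = \sum_(k in A) (C * (a * c ^+ d.-1)).
  rewrite sumr_const card_pffun_on card_bool -mulr_natl.
  rewrite (_ : #|mem r| = d.-1); first by ring.
  by rewrite (eq_card (B := predC1 i0)) ?cardC1 ?card_ord// => i; exact: mem_enum.
apply: ler_sum => k _.
have [phi phiE] := multilinear_linear FM (E k) i0.
rewrite -!phiE -linearB phiE.
apply: le_trans (symmetrization_bound fM f1 _ d0) _.
rewrite ler_wpM2l// (bigD1 i0)//= dfwithin; apply: ler_pM => //.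
- exact: prodr_ge0.
- have [psi [psi1 psiw]] := normK (w k x - w k y).
  apply: le_trans psiw _.
  (* The product of these functionals at [z] is [psi (w k z)]. *)
  pose phis i := if i == i0 then psi else g (k i).
  have phis1 i v : `|phis i v| <= `|v| by rewrite /phis; case: eqP.
  apply: le_trans _ (cross_norm_functionals x y phis1).
  have psiE z : psi (w k z) = \prod_(i < d) phis i z :> K.
    rewrite (bigD1 i0)//= {1}/phis eqxx linearZ/= /GRing.scale/= mulrC.
    by congr (_ * _); apply: eq_bigr => i /negbTE i_neq; rewrite /phis i_neq.
  by rewrite linearB !psiE.
- have -> : c ^+ d.-1 = \prod_(i < d | i != i0) c.
    by rewrite prodr_const cardC1 card_ord.
  apply: ler_prod => i i_neq; rewrite normr_ge0/= dfwithout ?e1//.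
  by rewrite eq_sym.
Qed.

End ReasonableCrossNorm.

(** * The Veronese cone *)

Section ProjectiveNorm.
Variable K : numFieldType.
Hypothesis supK : has_nonneg_sups K.
Variables (X : normedModType K) (d : nat).
Implicit Type u : stensor X d.

Definition symmetric_costs u := [set c : K |
  exists (n : nat) (lambda : 'I_n -> K) (x : 'I_n -> X),
    u = \sum_(i < n) lambda i *: tens_diag d (x i) /\
    c = \sum_(i < n) `|lambda i| * `|x i| ^+ d].

(** Ensures that [spi_norm] is a true infimum and not the default 0. *)
Lemma symmetric_costs_neq0 u : symmetric_costs u !=set0.
Proof.
have /asboolP[n [lambda [x uE]]] := valP u.
exists (\sum_(i < n) `|lambda i| * `|x i| ^+ d), n, lambda, x; split=> //.
apply: val_inj; rewrite uE raddf_sum; apply: eq_bigr => i _.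
by rewrite [RHS]linearZ.
Qed.

Lemma spi_norm_glb u : infimums (symmetric_costs u) (spi_norm u).
Proof.
apply: infimum_glb (symmetric_costs_neq0 u) _ => // _ [n [lambda [x [_ ->]]]].
by apply: sumr_ge0 => i _; rewrite mulr_ge0// exprn_ge0.
Qed.

Lemma spi_norm_tens_diag (x : X) : spi_norm (tens_diag d x) <= `|x| ^+ d.
Proof.
apply: (spi_norm_glb _).1; exists 1%N, (fun=> 1), (fun=> x).
by rewrite !big_ord1 scale1r normr1 mul1r.
Qed.

Lemma linear_spi_bound (Y : normedModType K) (L : {linear stensor X d -> Y}) s u :
  0 <= s -> (forall x, `|L (tens_diag d x)| <= s * `|x| ^+ d) ->
  `|L u| <= s * spi_norm u.
Proof.
move=> s0 Ls; have cost c : symmetric_costs u c -> `|L u| <= s * c.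
  move=> [n [lambda [x [-> ->]]]]; rewrite linear_sum mulr_sumr.
  apply: le_trans (ler_norm_sum _ _ _) _; apply: ler_sum => i _.
  by rewrite linearZ/= normrZ mulrCA ler_wpM2l.
(* Passing to the infimum over all costs divides by [s], so s = 0 is treated apart. *)
have [sE|sn0] := eqVneq s 0.
  by have [c /cost] := symmetric_costs_neq0 u; rewrite sE !mul0r.
have sp : 0 < s by rewrite lt_def sn0.
by rewrite -ler_pdivrMl//; apply: (spi_norm_glb u).2 => c /cost; rewrite ler_pdivrMl.
Qed.

(** Places the zero tensor on the cone, as the vertex with which x^d is compared. *)
Lemma tens_diag0 : (0 < d)%N -> tens_diag d (0 : X) = 0.
Proof.
by move=> d0; apply: val_inj; exact: multilinear_diag0 (@tens_multilinear K X d) d0.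
Qed.

Lemma veroneseP (u : veronese_cone X d) : exists x, u = veronese d x.
Proof.
have /set_mem[x _ xu] := valP u; exists x; apply: val_inj.
by rewrite /= xu.
Qed.

End ProjectiveNorm.

(** * The factorization and its Lipschitz constants *)

Section Factorization.
Variable K : numFieldType.
Hypothesis supK : has_nonneg_sups K.
Hypothesis normK : has_norming_functionals K.
Variables (X Y : normedModType K) (d : nat) (d0 : (0 < d)%N).
Variables (P : X -> Y) (T : ('I_d -> X) -> Y).
Hypotheses (TM : multilinear T) (PT : forall x, P x = T (fun=> x)).
Variables (E : completeNormedModType K) (iota : {linear stensor X d -> E}).
Hypothesis iotaN : forall u, `|iota u| = spi_norm u.
Variable TP : {linear E -> Y}.
Hypotheses (TPc : continuous TP) (TPP : forall x, P x = TP (iota (tens_diag d x))).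

(** T_P is bounded on the unit ball, which contains x^d when |x| <= 1. This makes [sup_norm P] a
    true supremum. *)
Lemma polynomial_bounded : exists M, forall x, `|x| <= 1 -> `|P x| <= M.
Proof.
have /(linear_bounded_continuous TP).2/bounded_funP/(_ 1)[M TPM] := TPc.
exists M => x x1; rewrite TPP; apply: TPM; rewrite iotaN.
by rewrite (le_trans (spi_norm_tens_diag supK _ _))// exprn_ile1.
Qed.

Lemma le_sup_norm_polynomial x : `|x| <= 1 -> `|P x| <= sup_norm P.
Proof. by have [M PM] := polynomial_bounded; exact: le_sup_norm PM. Qed.

Lemma sup_norm_polynomial_ge0 : 0 <= sup_norm P.
Proof. by apply: le_trans (le_sup_norm_polynomial (x := 0) _); rewrite ?normr0. Qed.

(** Only distances to the vertex enter, so [dist] stays abstract and the lemma serves d_{s,pi} and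
    d_alpha alike. *)
Lemma sup_norm_le_lipschitz (dist : veronese_cone X d -> veronese_cone X d -> K) L :
  (forall x, dist (veronese d x) (veronese d 0) <= `|x| ^+ d) ->
  lipschitz_bounds dist (cone_restriction iota TP) L -> sup_norm P <= L.
Proof.
move=> dist_le [L0 TL]; have [M PM] := polynomial_bounded.
apply: (sup_norm_le supK) => x x1.
have := TL (veronese d x) (veronese d 0).
rewrite /cone_restriction /= -!TPP PT [P 0]PT.
rewrite (multilinear_diag0 TM d0) subr0 => /le_trans; apply.
rewrite -[leRHS]mulr1 ler_wpM2l//.
by rewrite (le_trans (dist_le x))// exprn_ile1.
Qed.

Lemma cone_restriction_lipschitz :
  lipschitz_bounds (@spi_dist K X d) (cone_restriction iota TP) (sup_norm P).
Proof.
split=> [|u v]; first exact: sup_norm_polynomial_ge0.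
have [L LE] : exists L : {linear stensor X d -> Y}, L =1 (fun u => TP (iota u)).
  by apply: linear_pack => a x y; rewrite !linearP.
rewrite /cone_restriction -!LE -linearB.
apply: (linear_spi_bound supK); first exact: sup_norm_polynomial_ge0.
move=> x; rewrite LE -TPP PT; apply: diag_bound => // z z1.
by rewrite -PT le_sup_norm_polynomial.
Qed.

Lemma cone_restriction_lipschitz_cross (alpha : tensor X d -> K) :
  reasonable_cross_norm alpha ->
  lipschitz_bounds (norm_dist alpha) (cone_restriction iota TP)
    ((2 ^ d.-1 * d ^ d)%N%:R / (d`!)%N%:R * sup_norm P).
Proof.
move=> alphaP; split=> [|u v].
  by rewrite mulr_ge0 ?divr_ge0 ?sup_norm_polynomial_ge0.
have [x ->] := veroneseP u; have [y ->] := veroneseP v.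
rewrite /cone_restriction /= -!TPP !PT.
apply: (polynomial_cross_norm_bound supK normK) => // z z1.
by rewrite -PT le_sup_norm_polynomial.
Qed.

Lemma cone_factorization :
  [/\ lipschitz_map (@spi_dist K X d) (cone_restriction iota TP),
      P = cone_restriction iota TP \o @veronese K X d,
      lip_const (@spi_dist K X d) (cone_restriction iota TP) = sup_norm P
    & forall alpha : tensor X d -> K, reasonable_cross_norm alpha ->
        [/\ lipschitz_map (norm_dist alpha) (cone_restriction iota TP),
            sup_norm P <=
              lip_const (norm_dist alpha) (cone_restriction iota TP)
          & lip_const (norm_dist alpha) (cone_restriction iota TP) <=
              (2 ^ d.-1 * d ^ d)%N%:R / (d`!)%N%:R * sup_norm P]].
Proof.
have lip_spi := cone_restriction_lipschitz.
split.
- by exists (sup_norm P).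
- by apply/funext => x; rewrite TPP.
- apply/le_anti; rewrite lip_const_le//=; apply: le_lip_const => // [|L].
    by exists (sup_norm P).
  apply: sup_norm_le_lipschitz => x.
  by rewrite /spi_dist/= tens_diag0// subr0 spi_norm_tens_diag.
- move=> alpha alphaP; have lip_alpha := cone_restriction_lipschitz_cross alphaP.
  have [_ alpha_le _] := alphaP.
  split; [by eexists; exact: lip_alpha| |exact: lip_const_le].
  apply: le_lip_const => // [|L]; first by eexists; exact: lip_alpha.
  apply: sup_norm_le_lipschitz => x.
  have -> : norm_dist alpha (veronese d x) (veronese d 0) = alpha (tens (fun=> x)).
    have /(congr1 val) /= t0 := tens_diag0 X d0.
    by rewrite /norm_dist/= t0 subr0.
  by apply: le_trans (alpha_le _) _; rewrite prodr_const card_ord.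
Qed.

End Factorization.

Theorem theorem3p1 (R : realType) (K : numFieldType)
    (hK : K = R :> numFieldType \/ K = R[i] :> numFieldType)
    (X Y : completeNormedModType K) (d : nat) (hd : (0 < d)%N)
    (P : X -> Y) (hP : homogeneous_polynomial d P)
    (E : completeNormedModType K) (iota : {linear stensor X d -> E})
    (hE : spi_completion iota)
    (TP : {linear E -> Y}) (hTP : continuous TP)
    (hTPP : forall x : X, P x = TP (iota (tens_diag d x))) :
  [/\ lipschitz_map (@spi_dist K X d) (cone_restriction iota TP),
      P = cone_restriction iota TP \o @veronese K X d,
      lip_const (@spi_dist K X d) (cone_restriction iota TP) = sup_norm P
    & forall alpha : tensor X d -> K, reasonable_cross_norm alpha ->
        [/\ lipschitz_map (norm_dist alpha) (cone_restriction iota TP),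
            sup_norm P <=
              lip_const (norm_dist alpha) (cone_restriction iota TP)
          & lip_const (norm_dist alpha) (cone_restriction iota TP) <=
              (2 ^ d.-1 * d ^ d)%N%:R / (d`!)%N%:R * sup_norm P]].
Proof.
have [T [TM _ PT]] := hP; have [iotaN _] := hE.
suff [supK normK] : has_nonneg_sups K /\ has_norming_functionals K.
  exact: (cone_factorization supK normK hd TM PT iotaN hTP hTPP).
by case: hK => ->; split; [exact: real_nonneg_sups|exact: real_norming_functionals
  |exact: complex_nonneg_sups|exact: complex_norming_functionals].
Qed.
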